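(* Let $R$ be a commutative ring with $1$ and $q\in\Lambda(n)$. Then the right $RS_n$-module $X^q_R=\Xi^qRS_n$ is a free $R$-module with basis $\{\Xi^q w: w\in\mathscr{B}_q\}$ (products in $RS_n$). In particular its rank is $\sum_{\lambda}\frac{n!}{\lambda?}$, the sum over partitions $\lambda$ of $n$ with $\lambda\preccurlyeq q$, i.e. the number of permutations of $S_n$ whose cycle type weakly refines $q$.
   Context: Permutations act on the right and compose left to right; $\sigma\in S_n$ is identified with the word $w_1\cdots w_n$, $w_i=(i)\sigma$. For a composition $q=(q_1,\dots,q_k)$ of $n$, $\Xi^q\in RS_n$ is the sum of all $\sigma$ whose descents ($i$ with $(i)\sigma>(i+1)\sigma$) lie in $\{q_1,q_1+q_2,\dots,q_1+\dots+q_k\}$. $r\preccurlyeq q$ (weak refinement) means some rearrangement of $r$ is the concatenation of compositions of $q_1,\dots,q_k$ in order. $\lambda?=\prod_i i^{m_i(\lambda)}m_i(\lambda)!$ with $m_i$ the number of parts equal to $i$. Pivots: for $w=w_1\cdots w_n\in S_n$ put $\rho_0=0$ and, while $\rho_i<n$, let $\rho_{i+1}$ be the position of the smallest letter among $w_{\rho_i+1},\dots,w_n$; this stops at $\rho_\ell=n$. The pivot cycle type of $w$ is the composition $(\rho_1-\rho_0,\rho_2-\rho_1,\dots,\rho_\ell-\rho_{\ell-1})$ of $n$. $\mathscr{B}_q$ is the set of $w\in S_n$ whose pivot cycle type is a weak refinement of $q$. *)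

(* Defs.v *)
From HB Require Import structures.
From mathcomp Require Import all_boot all_order all_algebra all_fingroup.
From Stdlib Require Import ClassicalEpsilon.
Set Implicit Arguments. Unset Strict Implicit. Unset Printing Implicit Defensive.
Import GRing.Theory.
Local Open Scope ring_scope.

Definition is_comp (m : nat) (c : seq nat) : bool :=
  all (fun x => 0 < x)%N c && (sumn c == m).

Definition wref (r q : seq nat) : Prop :=
  exists cs : seq (seq nat),
    [/\ size cs = size q,
        (forall i, (i < size q)%N -> is_comp (nth 0%N q i) (nth [::] cs i))
      & perm_eq r (flatten cs)].

Definition wrefb (r q : seq nat) : bool :=
  if excluded_middle_informative (wref r q) then true else false.

Definition zee (l : seq nat) : nat :=
  (\prod_(i <- undup l) (i ^ (count_mem i l) * (count_mem i l)`!))%N.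

(* partitions of n, encoded as weakly decreasing n-tuples over {0..n} with
   sum n, padded with zeros; the partition itself is the positive entries *)
Definition tup_is_partition (n : nat) (t : n.-tuple 'I_n.+1) : bool :=
  sorted geq (map val t) && (sumn (map val t) == n).
Definition tup_partition (n : nat) (t : n.-tuple 'I_n.+1) : seq nat :=
  filter (fun x => 0 < x)%N (map val t).

(* word w_1 ... w_n of s (letters shifted to 0..n-1, order unaffected) *)
Definition word (n : nat) (s : 'S_n) : seq nat := [seq val (s i) | i <- enum 'I_n].

Definition psums (q : seq nat) : seq nat :=
  [seq sumn (take k q) | k <- iota 1 (size q)].

(* all descents of s lie in psums q; position i (0-based) and i+1 form a
   descent at the 1-based position i+1 *)
Definition desc_in (n : nat) (q : seq nat) (s : 'S_n) : bool :=
  [forall i : 'I_n, forall j : 'I_n,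
     ((val j == (val i).+1) && (s j < s i)%N) ==> ((val i).+1 \in psums q)].

Definition seqmin (w : seq nat) : nat := foldr minn (head 0%N w) w.
Fixpoint pct_fuel (f : nat) (w : seq nat) : seq nat :=
  match f with
  | 0 => [::]
  | f'.+1 =>
      if w is [::] then [::]
      else let k := index (seqmin w) w in k.+1 :: pct_fuel f' (drop k.+1 w)
  end.
Definition pivot_type (n : nat) (s : 'S_n) : seq nat :=
  pct_fuel (size (word s)) (word s).

Definition cycle_type (n : nat) (s : 'S_n) : seq nat :=
  [seq #|(X : {set 'I_n})| | X <- enum (porbits s)].

Definition Bq (n : nat) (q : seq nat) : {set 'S_n} :=
  [set w : 'S_n | wrefb (pivot_type w) q].

Definition gmul (R : comPzRingType) (n : nat) (a b : {ffun 'S_n -> R^o})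
  : {ffun 'S_n -> R^o} :=
  [ffun g => \sum_(h : 'S_n) a h * b (h^-1 * g)%g].

Definition gdelta (R : comPzRingType) (n : nat) (w : 'S_n) : {ffun 'S_n -> R^o} :=
  [ffun g => if g == w then 1 else 0].

Definition Xi (R : comPzRingType) (n : nat) (q : seq nat) : {ffun 'S_n -> R^o} :=
  [ffun s => if desc_in q s then 1 else 0].

(* Main.v *)
Require Import Defs.
From Stdlib Require Import ClassicalEpsilon.
From HB Require Import structures.
From mathcomp Require Import all_boot all_order all_algebra all_fingroup.
Set Implicit Arguments. Unset Strict Implicit. Unset Printing Implicit Defensive.
Import GRing.Theory.
Local Open Scope ring_scope.
Local Open Scope nat_scope.

(** The coefficient of a word [g] in [Xi^q w] is 1 if each of the consecutive blocks of [g] of sizes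
    [q_1, ..., q_k] is a subsequence of [w], and 0 otherwise. Cutting a word [w] after its pivots
    gives factors [s a] in which [a] is smaller than every letter of [s] and of the later factors;
    words are compared by the lexicographic order of their pivot types.

    Independence: if the pivot type of [w] weakly refines [q], its factors can be distributed over
    [k] colours with [q_j] letters of colour [j]. Let [g] list the letters of [w] colour by colour,
    in the order of [w]. Any word in which [g] occurs with coefficient 1 is a shuffle of the colour
    classes, and its pivot type is larger than that of [w] unless it is [w] itself.

    Spanning: replacing each factor [s_1 ... s_m a] of [w] by the Lie element
    [[s_1, [s_2, ... [s_m, a]]]] gives [w] plus a combination of words of smaller pivot type. A Lie
    element whose letters do not all lie in one block of [g] vanishes after restriction to the
    blocks, so [Xi^q] kills this product whenever the pivot type does not weakly refine [q].

    Rank: reading the factors as cycles is a bijection from words to permutations that turns pivot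
    types into cycle types. Words of a given pivot type are counted by deleting the first letter. *)

(** * Pivot types of words and the factorization after the pivots *)

Definition pivots (v : seq nat) : seq nat := pct_fuel (size v) v.

Lemma foldr_minn_split a d s t :
  a <= d -> all (leq a) s -> all (leq a) t -> foldr minn d (s ++ a :: t) = a.
Proof.
move=> ad sa ta; elim: s sa => [_|x s IHs /= /andP[ax sa]] /=.
  apply/minn_idPl; elim: t ta => //= x t IHt /andP[ax ta].
  by rewrite leq_min ax IHt.
by rewrite IHs //; apply/minn_idPr.
Qed.

Lemma seqmin_split a s t :
  all (leq a) s -> all (leq a) t -> seqmin (s ++ a :: t) = a.
Proof. by move=> sa ta; apply: foldr_minn_split => //; case: s sa => //= x s /andP[]. Qed.

Lemma pct_fuel_split f a s t :
  a \notin s -> all (leq a) s -> all (leq a) t ->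
  pct_fuel f.+1 (s ++ a :: t) = (size s).+1 :: pct_fuel f t.
Proof.
move=> aNs sa ta.
rewrite /= seqmin_split //.
have -> : index a (s ++ a :: t) = size s by rewrite index_cat (negbTE aNs) /= eqxx addn0.
have -> : drop (size s).+1 (s ++ a :: t) = t.
  by rewrite -cat_rcons -(size_rcons s a) drop_size_cat.
by case: s {aNs sa}.
Qed.

Lemma min_split v : v != [::] -> uniq v ->
  exists s a t, [/\ v = s ++ a :: t, all (ltn a) s & all (ltn a) t].
Proof.
elim: v => // x v IHv _ /= /andP[xNv vu].
have [->|vn0] := eqVneq v [::]; first by exists [::], x, [::].
have [s [a [t [def_v sa ta]]]] := IHv vn0 vu.
have [ax|xa|eq_xa] := ltngtP a x; last 1 first.
- by case/negP: xNv; rewrite def_v mem_cat -eq_xa inE eqxx orbT.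
- by exists (x :: s), a, t; rewrite def_v /= ax.
exists [::], x, v; split=> //; rewrite def_v all_cat /= xa /=.
by apply/andP; split; apply/allP=> y ys; apply: ltn_trans xa _; [apply: (allP sa)|apply: (allP ta)].
Qed.

Lemma ltn_all_notin a s : all (ltn a) s -> a \notin s.
Proof. by move=> sa; apply/negP=> /(allP sa) /=; rewrite ltnn. Qed.

Lemma ltn_all_leq a s : all (ltn a) s -> all (leq a) s.
Proof. by apply: sub_all => x; apply: ltnW. Qed.

(** Each pass consumes at least one letter, so fuel beyond the length changes nothing; a suffix can
    then be treated as a word of its own. *)
Lemma pct_fuelE f v : uniq v -> size v <= f -> pct_fuel f v = pivots v.
Proof.
elim/ltn_ind: f v => f IHf v vu vf.
have [->|vn0] := eqVneq v [::]; first by case: f {IHf vf}.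
have [s [a [t [def_v sa ta]]]] := min_split vn0 vu.
have tu : uniq t by move: vu; rewrite def_v cat_uniq /= => /and3P[_ _ /andP[]].
case: f vf IHf => [|f]; first by rewrite leqn0 size_eq0 (negbTE vn0).
have sz_v : size v = (size s + size t).+1 by rewrite def_v size_cat addnS.
rewrite /pivots sz_v def_v ltnS => vf IHf.
have [aNs sal tal] := And3 (ltn_all_notin sa) (ltn_all_leq sa) (ltn_all_leq ta).
rewrite (pct_fuel_split f) // (pct_fuel_split (size s + size t)) //.
by rewrite !IHf ?leq_addl ?ltnS ?(leq_trans (leq_addl _ _) vf).
Qed.

Lemma pivots_split a s t : uniq t -> all (ltn a) s -> all (ltn a) t ->
  pivots (s ++ a :: t) = (size s).+1 :: pivots t.
Proof.
move=> tu sa ta; rewrite /pivots size_cat /= addnS pct_fuel_split.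
- by rewrite pct_fuelE // leq_addl.
- exact: ltn_all_notin.
- exact: ltn_all_leq.
- exact: ltn_all_leq.
Qed.

(** An inductive form of the factorization, so that later arguments recurse on factors instead of
    fuel. The letter [a] closing a factor is a pivot. *)
Inductive pivot_fact : seq (seq nat) -> Prop :=
| PivotNil : pivot_fact [::]
| PivotCons s a us of all (ltn a) s & all (ltn a) (flatten us) & pivot_fact us :
    pivot_fact (rcons s a :: us).

Lemma pivot_factP v : uniq v -> exists2 us, pivot_fact us & flatten us = v.
Proof.
elim: {v}(size v) {-2}v (leqnn (size v)) => [|n IHn] v.
  by rewrite leqn0 size_eq0 => /eqP-> _; exists [::] => //; constructor.
have [-> _ _|vn0] := eqVneq v [::]; first by exists [::] => //; constructor.
move=> vn vu; have [s [a [t [def_v sa ta]]]] := min_split vn0 vu.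
have tu : uniq t by move: vu; rewrite def_v cat_uniq /= => /and3P[_ _ /andP[]].
have tn : size t <= n.
  by move: vn; rewrite def_v size_cat /= addnS ltnS; apply: leq_trans; apply: leq_addl.
have [us usP def_t] := IHn t tn tu.
by exists (rcons s a :: us); [constructor; rewrite ?def_t | rewrite /= def_t cat_rcons].
Qed.

Lemma pivots_flatten us : pivot_fact us -> uniq (flatten us) ->
  pivots (flatten us) = shape us.
Proof.
elim=> // s a {}us sa usa usP IHus /=; rewrite cat_uniq => /and3P[_ _ usu].
by rewrite cat_rcons pivots_split // IHus // size_rcons.
Qed.

Lemma sumn_pivots v : uniq v -> sumn (pivots v) = size v.
Proof.
by move=> vu; have [us usP def_v] := pivot_factP vu; rewrite -def_v pivots_flatten ?def_v // -def_v size_flatten.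
Qed.

Lemma pivots_gt0 v : uniq v -> all (ltn 0) (pivots v).
Proof.
move=> vu; have [us usP def_v] := pivot_factP vu; rewrite -def_v pivots_flatten ?def_v //.
by elim: usP {def_v} => //= s a {}us _ _ _ ->; rewrite size_rcons.
Qed.

(** * Lexicographic comparison of pivot types *)

Definition lexlt (s t : seq nat) : bool := (s < t :> seqlexi nat)%O.

Lemma lexlt_cons x s y t : lexlt (x :: s) (y :: t) = (x < y) || (x == y) && lexlt s t.
Proof.
rewrite /lexlt ltxi_cons !leEnat.
by case: ltngtP.
Qed.

Lemma lexlt_trans : transitive lexlt.
Proof. by move=> t s u; apply: Order.POrderTheory.lt_trans. Qed.

Lemma lexlt_irr : irreflexive lexlt.
Proof. by move=> s; apply: Order.POrderTheory.lt_irreflexive. Qed.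

Definition mono (col : nat -> nat) (u : seq nat) : bool :=
  all (fun x => col x == col (last 0 u)) u.

Lemma cat_rcons_inj (a : nat) s1 t1 s2 t2 : a \notin s1 -> a \notin s2 ->
  s1 ++ a :: t1 = s2 ++ a :: t2 -> s1 = s2 /\ t1 = t2.
Proof.
elim: s1 s2 => [|x s1 IHs] [|y s2] //=.
- by move=> _ _ [].
- by move=> _; rewrite inE negb_or => /andP[/eqP ay _] [/ay].
- by rewrite inE negb_or => /andP[/eqP ay _] _ [/esym/ay].
rewrite !inE !negb_or => /andP[_ aN1] /andP[_ aN2] [-> /IHs].
by case/(_ aN1 aN2)=> -> ->.
Qed.

(** Deleting [a] on both sides leaves the same letters, so [a] remains the first pivot of the
    rearranged word. *)
Lemma min_split_perm a p r s t : perm_eq (p ++ a :: r) (s ++ a :: t) ->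
  all (ltn a) s -> all (ltn a) t -> all (ltn a) p /\ all (ltn a) r.
Proof.
rewrite -[a :: r]cat1s -[a :: t]cat1s perm_catCA perm_sym perm_catCA perm_cons perm_sym => pp sa ta.
by apply/andP; rewrite -all_cat (perm_all _ pp) all_cat sa.
Qed.

(* The minimum a of the first factor s a is preceded in v by all of s, and by nothing else only
   if v starts with s a as well. *)
Lemma shuffle_lexlt col us v : pivot_fact us -> uniq (flatten us) ->
  all (mono col) us -> perm_eq v (flatten us) ->
  (forall c, [seq x <- v | col x == c] = [seq x <- flatten us | col x == c]) ->
  v = flatten us \/ lexlt (pivots (flatten us)) (pivots v).
Proof.
move=> usP; elim: usP v => [|s a {}us sa usa usP IHus] v /=.
  by move=> _ _ /perm_size/eqP; rewrite size_eq0 => /eqP ->; left.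
move=> uu /andP[smono usmono] pv fv.
have usu : uniq (flatten us) by move: uu; rewrite cat_uniq => /and3P[].
have aNs := ltn_all_notin sa; have aNus := ltn_all_notin usa.
have vu : uniq v by rewrite (perm_uniq pv).
have /splitPr def_v : a \in v by rewrite (perm_mem pv) cat_rcons mem_cat inE eqxx orbT.
case: v / def_v pv fv vu => p r pv fv vu.
move: (vu); rewrite cat_uniq /= negb_or => /and3P[_ /andP[aNp _] /andP[aNr ru]].
have [pa ra] : all (ltn a) p /\ all (ltn a) r by move: pv; rewrite cat_rcons => /min_split_perm; apply.
(* Both words have the same restriction to the colour of [a]. In [flatten] it starts with all of
   [s a], a factor of one colour, so cutting at [a] yields [s]. *)
have [def_s _] : s = [seq x <- p | col x == col a] /\
    [seq x <- flatten us | col x == col a] = [seq x <- r | col x == col a].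
  apply: (@cat_rcons_inj a) => //; first by rewrite mem_filter (negbTE aNp) andbF.
  have := fv (col a); rewrite cat_rcons !filter_cat /= eqxx => ->.
  congr (_ ++ _); apply/esym/all_filterP; move: smono; rewrite /mono last_rcons all_rcons.
  by case/andP.
rewrite cat_rcons !pivots_split // lexlt_cons eqSS ltnS.
have [ss|] := ltnP (size s) (size p); first by right.
rewrite {1}def_s size_filter => sp.
(* [p] is no longer than its part of colour [col a], so the filter drops nothing. *)
have ps : p = s.
  rewrite def_s; apply/esym/all_filterP; rewrite all_count eqn_leq sp count_size //.
move: fv pv; rewrite -{}ps cat_rcons => fv; rewrite perm_cat2l perm_cons => pv.
have fr c : [seq x <- r | col x == c] = [seq x <- flatten us | col x == c].
  have := fv c; rewrite !filter_cat => /eqP; rewrite eqseq_cat // eqxx /= => /eqP.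
  by case: (col a == c) => // [[]].
have [->|lt_r] := IHus r usu usmono pv fr; first by left.
by right; rewrite eqxx lt_r orbT.
Qed.

(** * Lie elements and their vanishing on restriction to colour classes *)

Section LieElements.

Variable R : comPzRingType.

(** The intended [phi] sends [v] to the coefficient of a fixed word in [Xi^q v], which sees only the
    restrictions of [v] to the blocks. *)
Definition colour_invariant (col : nat -> nat) (phi : seq nat -> R) :=
  forall v w, (forall c, [seq x <- v | col x == c] = [seq x <- w | col x == c]) ->
  phi v = phi w.

(** The list encodes an integral combination of words, the boolean being the exponent of the sign;
    [phi] is extended linearly. *)
Definition signed_sum (L : seq (bool * seq nat)) (phi : seq nat -> R) : R :=
  (\sum_(p <- L) (-1) ^+ p.1 * phi p.2)%R.

(* The expansion of the Lie element [s_1, [s_2, ... [s_m, a]]]. *)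
Lemma lie_factor a s : a \notin s -> exists2 L : seq (bool * seq nat),
    {in L, forall p, perm_eq p.2 (rcons s a) /\ index a p.2 < size s} &
    forall col phi l r, colour_invariant col phi -> ~~ mono col (rcons s a) ->
    signed_sum ((false, rcons s a) :: L) (fun v => phi (l ++ v ++ r)) = 0%R.
Proof.
elim: s => [|x s IHs] /=.
  by move=> _; exists [::] => // col phi l r _; rewrite /mono /= eqxx.
rewrite inE negb_or => /andP[ax aNs]; have [L Lperm Lzero] := IHs aNs.
pose M := (false, rcons s a) :: L.
have Mperm : {in M, forall p, perm_eq p.2 (rcons s a)}.
  by move=> p; rewrite inE => /predU1P[-> //|/Lperm[]].
(* The bracket is [x M - M x]. Its leading word [x s a] is left out, so the first half runs over [L]
   only. *)
exists ([seq (p.1, x :: p.2) | p <- L] ++ [seq (~~ p.1, rcons p.2 x) | p <- M]).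
  move=> q; rewrite mem_cat => /orP[] /mapP[p pL ->] /=.
    by have [pp ip] := Lperm p pL; rewrite perm_cons pp eq_sym (negbTE ax).
  have pp := Mperm p pL; split; first by rewrite perm_rcons perm_cons.
  have ap : a \in p.2 by rewrite (perm_mem pp) mem_rcons inE eqxx.
  by rewrite -cats1 index_cat ap -(size_rcons s a) -(perm_size pp) index_mem.
move=> col phi l r phiP nmono.
have -> : signed_sum ((false, x :: rcons s a) :: [seq (p.1, x :: p.2) | p <- L] ++
    [seq (~~ p.1, rcons p.2 x) | p <- M]) (fun v => phi (l ++ v ++ r)) =
  (signed_sum M (fun v => phi (rcons l x ++ v ++ r)) -
   signed_sum M (fun v => phi (l ++ v ++ x :: r)))%R.
  rewrite /signed_sum -cat_cons -(map_cons (fun p => (p.1, x :: p.2)) (false, rcons s a)).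
  rewrite big_cat !big_map -sumrN; congr (_ + _)%R; apply: eq_bigr => p _ /=.
    by rewrite cat_rcons.
  by rewrite cat_rcons; case: p.1; rewrite /= ?expr0 ?expr1 ?mulN1r ?mul1r ?opprK.
(* If the inner bracket has several colours, it vanishes in both contexts. Otherwise [x] differs in
   colour from all its letters, and [phi] does not see on which side of them [x] stands. *)
have [smono|snmono] := boolP (mono col (rcons s a)); last first.
  by rewrite /M !(Lzero col phi _ _ phiP snmono) subr0.
have xa : col x != col a.
  by apply: contraNneq nmono => xa; move: smono; rewrite /mono /= !last_rcons xa eqxx.
apply/eqP; rewrite subr_eq0; apply/eqP; apply: eq_big_seq => p pM; congr (_ * _)%R.
apply: phiP => c; rewrite cat_rcons !filter_cat /= filter_cat; congr (_ ++ _).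
have [<-|//] := eqVneq (col x) c.
suff -> : [seq y <- p.2 | col y == col x] = [::] by [].
apply/eqP; rewrite -[_ == _]negbK -has_filter; apply/hasPn => y.
rewrite (perm_mem (Mperm p pM)) => /(allP smono); rewrite last_rcons => /eqP ->.
by rewrite eq_sym.
Qed.

(** Multiply the Lie elements of the factors. A term that differs from the leading one in the first
    factor has its minimum [a] further left, hence a smaller first part; the other terms are
    compared in the tail. The prefix [l] lets the induction hypothesis act behind a fixed first
    factor. *)
Lemma lie_product us : pivot_fact us -> uniq (flatten us) ->
  exists2 L : seq (bool * seq nat),
    {in L, forall p, perm_eq p.2 (flatten us) /\ lexlt (pivots p.2) (pivots (flatten us))} &
    forall col phi l, colour_invariant col phi -> ~~ all (mono col) us ->
    signed_sum ((false, flatten us) :: L) (fun v => phi (l ++ v)) = 0%R.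
Proof.
elim=> [|s a {}us sa usa usP IHus] /=; first by exists [::].
move=> uu; have usu : uniq (flatten us) by move: uu; rewrite cat_uniq => /and3P[].
have aNs := ltn_all_notin sa.
have [L1 L1perm L1zero] := lie_factor aNs; have [L2 L2perm L2zero] := IHus usu.
pose M1 := (false, rcons s a) :: L1; pose M2 := (false, flatten us) :: L2.
have M2perm : {in M2, forall p, perm_eq p.2 (flatten us)}.
  by move=> p; rewrite inE => /predU1P[-> //|/L2perm[]].
pose mul (p1 p2 : bool * seq nat) := (p1.1 (+) p2.1, p1.2 ++ p2.2).
exists ([seq mul (false, rcons s a) p2 | p2 <- L2] ++ [seq mul p1 p2 | p1 <- L1, p2 <- M2]).
  move=> p; rewrite mem_cat => /orP[/mapP[p2 p2L ->]|/allpairsP[[p1 p2] /= [p1L p2M ->]]] /=.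
    have [pp lt_p] := L2perm p2 p2L; rewrite perm_cat2l; split=> //.
    have p2u : uniq p2.2 by rewrite (perm_uniq pp).
    have p2a : all (ltn a) p2.2 by rewrite (perm_all _ pp).
    by rewrite !cat_rcons !pivots_split // lexlt_cons eqxx lt_p orbT.
  have [p1p ip1] := L1perm p1 p1L; have p2p := M2perm p2 p2M.
  have pp : perm_eq (p1.2 ++ p2.2) (rcons s a ++ flatten us) by apply: perm_cat.
  split=> //; have /splitPr def_p1 : a \in p1.2 by rewrite (perm_mem p1p) mem_rcons inE eqxx.
  case: p1.2 / def_p1 p1p ip1 pp => l r p1p ip1; rewrite cat_rcons -catA cat_cons => pp.
  have [la ra] := min_split_perm pp sa usa.
  have ru : uniq (r ++ p2.2).
    by move: uu; rewrite cat_rcons -(perm_uniq pp) cat_uniq => /and3P[_ _ /andP[]].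
  rewrite !pivots_split // lexlt_cons ltnS.
  suff -> : size l < size s by [].
  by move: ip1; rewrite index_cat (negbTE (ltn_all_notin la)) /= eqxx addn0.
move=> col phi l phiP; rewrite negb_and => nmono.
have -> : signed_sum ((false, rcons s a ++ flatten us) ::
    [seq mul (false, rcons s a) p2 | p2 <- L2] ++ [seq mul p1 p2 | p1 <- L1, p2 <- M2])
    (fun v => phi (l ++ v)) =
  (\sum_(p1 <- M1) \sum_(p2 <- M2)
     (-1) ^+ p1.1 * ((-1) ^+ p2.1 * phi (l ++ p1.2 ++ p2.2)))%R.
  transitivity (signed_sum [seq mul p1 p2 | p1 <- M1, p2 <- M2] (fun v => phi (l ++ v))) => //.
  rewrite /signed_sum big_allpairs_dep; apply: eq_bigr => p1 _; apply: eq_bigr => p2 _ /=.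
  by rewrite signr_addb mulrA.
have [smono|snmono] := boolP (mono col (rcons s a)).
  rewrite smono /= in nmono; apply: big1 => p1 _; rewrite -mulr_sumr.
  have := L2zero col phi (l ++ p1.2) phiP nmono; rewrite /signed_sum.
  under eq_bigr do rewrite -catA.
  by move=> ->; rewrite mulr0.
rewrite exchange_big; apply: big1 => p2 _.
transitivity ((-1) ^+ p2.1 * signed_sum M1 (fun v => phi (l ++ v ++ p2.2)))%R.
  by rewrite mulr_sumr; apply: eq_bigr => p1 _; rewrite mulrCA.
by rewrite (L1zero col phi l p2.2 phiP snmono) mulr0.
Qed.

End LieElements.

(** * Words and the action of [Xi] on them *)

Section Words.

Variable n : nat.
Implicit Types (s g w : 'S_n) (q v : seq nat).

Lemma size_word s : size (word s) = n.
Proof. by rewrite size_map size_enum_ord. Qed.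

Lemma nth_word s (i : 'I_n) : nth 0 (word s) i = s i.
Proof. by rewrite (nth_map i) ?size_enum_ord // nth_ord_enum. Qed.

Lemma word_uniq s : uniq (word s).
Proof.
rewrite map_inj_uniq ?enum_uniq //.
by move=> i j /val_inj/perm_inj.
Qed.

Lemma perm_word s : perm_eq (word s) (iota 0 n).
Proof.
apply: uniq_perm; rewrite ?word_uniq ?iota_uniq // => x; rewrite mem_iota add0n /=.
apply/mapP/idP=> [[i _ ->]|xn]; first exact: ltn_ord.
by exists (s^-1 (Ordinal xn))%g; rewrite ?mem_enum // permKV.
Qed.

Lemma word_inj : injective (@word n).
Proof. by move=> s t st; apply/permP=> i; apply: ord_inj; rewrite -!nth_word st. Qed.

Lemma word_surj v : perm_eq v (iota 0 n) -> exists s, word s = v.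
Proof.
move=> pv; have vn : size v = n by rewrite (perm_size pv) size_iota.
have vlt (i : 'I_n) : nth 0 v i < n.
  by have := mem_nth 0 (s := v) (n := i); rewrite vn (perm_mem pv) mem_iota; apply.
have vu : uniq v by rewrite (perm_uniq pv) iota_uniq.
have f_inj : injective (fun i => Ordinal (vlt i)).
  by move=> i j [/eqP]; rewrite nth_uniq ?vn // => /eqP/val_inj.
exists (perm f_inj); apply: (@eq_from_nth _ 0); rewrite size_word ?vn // => i lt_i.
by rewrite (nth_word _ (Ordinal lt_i)) permE.
Qed.

Lemma index_word s (x : 'I_n) : index (val x) (word s) = (s^-1 x)%g.
Proof. by rewrite -[in LHS](permKV s x) /= -nth_word index_uniq ?word_uniq // size_word. Qed.

(** The product acts by [g] first. Thus a descent of [g * w^-1] marks two consecutive letters of [g]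
    that occur in [w] in the opposite order. *)
Lemma word_mulV g w : word (g * w^-1)%g = [seq index x (word w) | x <- word g].
Proof. by rewrite [in RHS]/(word g) -map_comp; apply: eq_map => i; rewrite /= index_word permM. Qed.

Lemma psums_cons x q : psums (x :: q) = x :: [seq x + y | y <- psums q].
Proof.
rewrite /psums /= take0 addn0; congr (_ :: _).
by rewrite (iotaDl 1 1) -!map_comp; apply: eq_map => k.
Qed.

Lemma sorted_reshapeP q (v : seq nat) : size v = sumn q ->
  all (sorted ltn) (reshape q v) <->
  (forall i, i.+1 < size v -> i.+1 \notin psums q -> nth 0 v i < nth 0 v i.+1).
Proof.
elim: q v => [|x q IHq] v /= sv; first by rewrite sv.
have xv : x <= size v by rewrite sv leq_addr.
have sd : size (drop x v) = sumn q by rewrite size_drop sv addKn.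
rewrite psums_cons; split.
  case/andP=> /(sortedP 0) st /(IHq _ sd) IH i lt_i; rewrite inE negb_or => /andP[ix iq].
  (* [i.+1 = x], the border of the first block, is excluded, so the pair lies inside the first block
     or inside the rest. *)
  have [lt_ix|] := ltnP i.+1 x.
    by have := st i; rewrite size_takel // !nth_take //; [apply | apply: ltnW].
  rewrite leq_eqVlt eq_sym (negbTE ix) /= ltnS => le_xi.
  have := IH (i - x); rewrite sd !nth_drop addnS subnKC //; apply.
    by rewrite -subSn // ltn_subLR ?sv -?sv // leqW.
  apply: contra iq => iq; apply/mapP; exists (i - x).+1 => //.
  by rewrite addnS subnKC.
move=> lt_v; apply/andP; split.
  apply/(sortedP 0) => i; rewrite size_takel // => lt_i.
  rewrite !nth_take //; last exact: ltnW.
  apply: lt_v; first exact: leq_trans xv.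
  rewrite inE negb_or neq_ltn lt_i /=; apply/mapP=> [[y _ def_i]].
  by rewrite def_i ltnNge leq_addr in lt_i.
apply/(IHq _ sd) => i; rewrite size_drop ltn_subRL addnS => lt_i iq.
rewrite !nth_drop addnS; apply: lt_v => //.
rewrite inE negb_or; apply/andP; split.
  by rewrite -addnS -[X in _ != X]addn0 eqn_add2l.
by rewrite -addnS mem_map //; apply: addnI.
Qed.

Lemma sorted_index_subseq (b v : seq nat) : uniq v -> {subset b <= v} ->
  sorted ltn [seq index x v | x <- b] = subseq b v.
Proof.
move=> vu bv; apply/idP/idP => [sb|/map_subseq sb].
  have -> : b = [seq nth 0 v i | i <- [seq index x v | x <- b]].
    by rewrite -map_comp map_id_in // => x /bv xv; rewrite /= nth_index.
  rewrite -[X in subseq _ X](mkseq_nth 0 v); apply: map_subseq.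
  (* A strictly increasing list is determined by its members, so it is a filtered range. *)
  suff -> : [seq index x v | x <- b] = [seq i <- iota 0 (size v) | i \in [seq index x v | x <- b]].
    exact: filter_subseq.
  apply: (irr_sorted_eq ltn_trans ltnn) => //.
    by apply: sorted_filter; [apply: ltn_trans | apply: iota_ltn_sorted].
  move=> i; rewrite mem_filter; apply: esym; apply: andb_idr.
  by case/mapP=> x /bv xv ->; rewrite mem_iota index_mem.
apply: (subseq_sorted ltn_trans (sb _ (index^~ v))).
suff -> : [seq index x v | x <- v] = iota 0 (size v) by apply: iota_ltn_sorted.
apply: (@eq_from_nth _ 0); rewrite size_map ?size_iota // => i lt_i.
by rewrite (nth_map 0) // index_uniq // nth_iota.
Qed.

(** A block of [g * w^-1] lists the positions in [w] of a block of [g]; these increase exactly when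
    [w] contains that block as a subsequence. *)
Lemma desc_in_mulV q g w : sumn q = n ->
  desc_in q (g * w^-1)%g = all (subseq^~ (word w)) (reshape q (word g)).
Proof.
move=> qn; have sg : size (word g) <= sumn q by rewrite size_word qn.
have -> : all (subseq^~ (word w)) (reshape q (word g)) =
          all (sorted ltn) (reshape q (word (g * w^-1)%g)).
  rewrite word_mulV -map_reshape all_map; apply: eq_in_all => b bg /=.
  rewrite sorted_index_subseq ?word_uniq // => x xb.
  rewrite (perm_mem (perm_word w)) -(perm_mem (perm_word g)) -(reshapeKr sg).
  by apply/flattenP; exists b.
set s := (g * w^-1)%g.
have /sorted_reshapeP sP : size (word s) = sumn q by rewrite size_word qn.
apply/idP/idP => [/forallP desc|/sP sorted_s].
  apply/sP => i; rewrite size_word => lt_i iq.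
  have := desc (Ordinal (ltnW lt_i)) => /forallP/(_ (Ordinal lt_i)).
  rewrite (nth_word _ (Ordinal (ltnW lt_i))) (nth_word _ (Ordinal lt_i)) /= eqxx (negbTE iq) implybF -leqNgt.
  rewrite leq_eqVlt => /orP[/eqP/val_inj/perm_inj/(congr1 val)/= /n_Sn[]|//].
apply/forallP=> i; apply/forallP=> j; apply/implyP=> /andP[/eqP ji lt_s].
apply: contraT => iq; have := sorted_s i; rewrite size_word -ji !nth_word => /(_ (ltn_ord j)).
by rewrite ji => /(_ iq); rewrite ltnNge (ltnW lt_s).
Qed.

Lemma Xi_delta (R : comPzRingType) q g w : sumn q = n ->
  gmul (Xi R n q) (gdelta R w) g = (all (subseq^~ (word w)) (reshape q (word g)))%:R%R.
Proof.
move=> qn; rewrite ffunE (bigD1 (g * w^-1)%g) //= big1 => [|h hg].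
  rewrite !ffunE invMg invgK mulgKV eqxx desc_in_mulV // addr0 mulr1.
  by case: all.
rewrite !ffunE [in X in (_ * X)%R]ifF ?mulr0 //.
by apply: contraNF hg => /eqP <-; rewrite invMg invgK mulKVg.
Qed.

End Words.

(** * Weak refinements as colourings *)

Lemma perm_flatten_filter (T : eqType) (f : T -> nat) k s : all (fun x => f x < k) s ->
  perm_eq s (flatten [seq [seq x <- s | f x == j] | j <- iota 0 k]).
Proof.
move=> sk; apply/allP => a _ /=; rewrite -!sum1_count big_flatten big_map /=.
under [X in _ == X]eq_bigr => j _ do rewrite big_filter_cond big_mkcond.
rewrite exchange_big big_mkcond; apply/eqP; apply: eq_big_seq => x xs.
have xk : f x \in iota 0 k by rewrite mem_iota (allP sk).
rewrite (bigD1_seq (f x)) ?iota_uniq //= eqxx big1 ?addn0 // => j.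
by rewrite eq_sym => /negbTE ->.
Qed.

(** A label names the part of [q] to which a part of [r] is assigned. Keeping the labels in the
    order of [r], which [wref] forgets, allows handing them to the factors of a word. *)
Lemma wref_labelsP r q : all (ltn 0) r ->
  wref r q <-> exists L : seq (nat * nat), [/\ unzip1 L = r, all (fun p => p.2 < size q) L &
    forall j, j < size q -> \sum_(p <- L | p.2 == j) p.1 = nth 0 q j].
Proof.
move=> r0; split=> [[cs [szc cqs pr]]|[L [Lr Lk sL]]].
  pose L0 := flatten [seq [seq (x, j) | x <- nth [::] cs j] | j <- iota 0 (size q)].
  have L0cs : unzip1 L0 = flatten cs.
    rewrite /unzip1 map_flatten -map_comp; congr flatten.
    rewrite -[RHS](mkseq_nth [::]) szc; apply: eq_map => j /=.
    by rewrite -map_comp map_id.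
  rewrite -L0cs in pr; case/(perm_iotaP 0): (pr) => Is pIs def_r.
  have pL : perm_eq [seq nth (0, 0) L0 i | i <- Is] L0.
    by apply/(perm_iotaP (0, 0)); exists Is => //; move: pIs; rewrite size_map.
  exists [seq nth (0, 0) L0 i | i <- Is]; split.
  - rewrite def_r /unzip1 -map_comp; apply/eq_in_map => i.
    rewrite (perm_mem pIs) mem_iota size_map /= => lt_i.
    by rewrite (nth_map (0, 0)).
  - rewrite (perm_all _ pL); apply/allP=> p /flatten_mapP[j].
    by rewrite mem_iota add0n => /= lt_j /mapP[x _ ->].
  move=> j lt_j; rewrite (perm_big _ pL) big_flatten big_map /=.
  under eq_bigr => i _ do rewrite big_map /=.
  rewrite (bigD1_seq j) ?iota_uniq ?mem_iota //= eqxx [X in _ + X]big1 ?addn0.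
    by have /andP[_ /eqP <-] := cqs j lt_j; rewrite sumnE.
  by move=> i /negbTE ij; rewrite big_pred0 // => x; rewrite ij.
exists [seq [seq p.1 | p <- L & p.2 == j] | j <- iota 0 (size q)]; split.
- by rewrite size_map size_iota.
- move=> j lt_j; rewrite (nth_map 0) ?size_iota // nth_iota // add0n; apply/andP; split.
    apply/allP=> x /mapP[p]; rewrite mem_filter => /andP[_ pL] ->.
    by apply: (allP r0); rewrite -Lr map_f.
  by rewrite sumnE big_map big_filter sL.
by rewrite (map_comp (map _)) -map_flatten -Lr perm_map // perm_flatten_filter.
Qed.

(** Each factor is coloured by its label; the letters are distinct, so these choices do not
    interfere. *)
Lemma mono_colouring us L k : uniq (flatten us) -> unzip1 L = shape us ->
  all (fun p => p.2 < k) L ->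
  exists col, [/\ all (mono col) us, {in flatten us, forall x, col x < k} &
    forall j, count (fun x => col x == j) (flatten us) = \sum_(p <- L | p.2 == j) p.1].
Proof.
elim: us L => [|u us IHus] [|[m c] L] //=.
  by move=> _ _ _; exists (fun=> 0); split=> // j; rewrite big_nil.
rewrite cat_uniq => /and3P[uu uNus usu] [-> Lus] /andP[ck Lk].
have [col [cmono colk ccol]] := IHus L usu Lus Lk.
pose col' x := if x \in u then c else col x.
have col'u : {in u, col' =1 fun=> c} by move=> x xu; rewrite /col' xu.
have col'us : {in flatten us, col' =1 col}.
  by move=> x /(hasPn uNus) /negbTE /= xu; rewrite /col' xu.
exists col'; split.
- apply/andP; split.
    by apply/allP=> x xu; rewrite !col'u //; case: (u) xu => // y u' _; apply: mem_last.
  apply/allP=> u' u'us; have /allP := allP cmono u' u'us.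
  have sub : {subset u' <= flatten us} by move=> y yu'; apply/flattenP; exists u'.
  move=> mu'; apply/allP=> y yu'; rewrite !col'us ?sub ?mu' //.
  by case: u' yu' {u'us sub mu'} => // z u' _; apply: mem_last.
- move=> x; rewrite mem_cat => /orP[xu|xus]; first by rewrite col'u.
  by rewrite col'us ?colk.
move=> j; rewrite count_cat big_cons /=.
have -> : count (fun x => col' x == j) u = if c == j then size u else 0.
  rewrite (eq_in_count (a2 := fun=> c == j)) => [|x xu]; last by rewrite /= col'u.
  by case: (c == j); rewrite ?count_predT ?count_pred0.
rewrite (eq_in_count (a2 := fun x => col x == j)) => [|x xu]; last by rewrite /= col'us.
by rewrite ccol; case: (c == j).
Qed.

(** This direction serves independence, its converse [mono_wref] serves spanning. *)
Lemma wref_mono us q : uniq (flatten us) -> all (ltn 0) (shape us) -> wref (shape us) q ->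
  exists col, [/\ all (mono col) us, {in flatten us, forall x, col x < size q} &
    forall j, j < size q -> count (fun x => col x == j) (flatten us) = nth 0 q j].
Proof.
move=> uu us0 /(wref_labelsP _ us0)[L [Lus Lk sL]].
have [col [cmono colk ccol]] := mono_colouring uu Lus Lk.
by exists col; split=> // j lt_j; rewrite ccol sL.
Qed.

Lemma mono_wref us q col : all (ltn 0) (shape us) -> all (mono col) us ->
  {in flatten us, forall x, col x < size q} ->
  (forall j, j < size q -> count (fun x => col x == j) (flatten us) = nth 0 q j) ->
  wref (shape us) q.
Proof.
move=> us0 cmono colk ccol; apply/(wref_labelsP _ us0).
exists [seq (size u, col (last 0 u)) | u <- us]; split.
- by rewrite /unzip1 -map_comp.
- rewrite all_map; apply/allP=> u uus /=; apply: colk; apply/flattenP; exists u => //.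
  have : 0 < size u by apply: (allP us0); apply: map_f.
  by case: u {uus} => // x u _; apply: mem_last.
move=> j lt_j; rewrite -ccol // big_map count_flatten sumnE big_map big_mkcond.
apply: eq_big_seq => u uus; have /allP mu := allP cmono u uus.
rewrite (eq_in_count (a2 := fun=> col (last 0 u) == j)) => [|x xu]; last by rewrite /= (eqP (mu x xu)).
by case: eqP; rewrite ?count_predT ?count_pred0.
Qed.

Lemma find_block (T : eqType) (bs : seq (seq T)) x j : uniq (flatten bs) -> j < size bs ->
  x \in nth [::] bs j -> find (fun b => x \in b) bs = j.
Proof.
elim: bs j => //= b bs IHbs [|j]; rewrite cat_uniq => /and3P[_ bNbs bsu] lt_j /=.
  by move=> ->.
move=> xj; rewrite (IHbs j) // ifF //.
have xbs : x \in flatten bs by apply/flattenP; exists (nth [::] bs j) => //; apply: mem_nth.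
exact: (negbTE (hasPn bNbs x xbs)).
Qed.

Lemma uniq_nth_flatten (T : eqType) (bs : seq (seq T)) j : uniq (flatten bs) -> uniq (nth [::] bs j).
Proof.
by elim: bs j => [|b bs IHbs] [|j] //=; rewrite cat_uniq => /and3P[bu _] // /IHbs.
Qed.

(** * The basis *)

(** By [Xi_delta] this is the coefficient of [G] in [Xi^q v]. *)
Definition unshuffles q (G v : seq nat) : bool := all (subseq^~ v) (reshape q G).

Section Basis.

Variables (n : nat) (q : seq nat).
Hypothesis hq : is_comp n q.

Lemma is_comp_sumn : sumn q = n. Proof. by case/andP: hq => _ /eqP. Qed.

Lemma wrefbP r : reflect (wref r q) (wrefb r q).
Proof. by rewrite /wrefb; case: excluded_middle_informative => H; constructor. Qed.

(** This is the triangularity behind independence: the coefficient at [g] is 1 for [w] and 0 for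
    every other word whose pivot type is not larger. *)
Lemma pivot_test (w : 'S_n) : w \in Bq n q ->
  exists2 g : 'S_n, unshuffles q (word g) (word w) &
  forall w' : 'S_n, unshuffles q (word g) (word w') ->
    w' = w \/ lexlt (pivots (word w)) (pivots (word w')).
Proof.
rewrite inE => /wrefbP; rewrite -[pivot_type w]/(pivots (word w)).
have [us usP def_w] := pivot_factP (word_uniq w).
have uu : uniq (flatten us) by rewrite def_w word_uniq.
have us0 : all (ltn 0) (shape us) by rewrite -pivots_flatten // pivots_gt0.
rewrite -{1}def_w pivots_flatten // => /(wref_mono uu us0)[col [cmono colk ccol]].
pose bs := [seq [seq x <- word w | col x == j] | j <- iota 0 (size q)].
have pbs : perm_eq (word w) (flatten bs).
  by apply: perm_flatten_filter; apply/allP=> x xw; apply: colk; rewrite def_w.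
have [g def_g] : exists g : 'S_n, word g = flatten bs.
  by apply: word_surj; rewrite -(permPl pbs) perm_word.
have shbs : shape bs = q.
  apply: (@eq_from_nth _ 0); rewrite !size_map size_iota // => j lt_j.
  rewrite (nth_map [::]) ?size_map ?size_iota // (nth_map 0) ?size_iota //.
  by rewrite nth_iota // add0n size_filter -ccol // def_w.
have ubs v : unshuffles q (word g) v = all (subseq^~ v) bs.
  by rewrite /unshuffles def_g -{1}shbs flattenK.
exists g => [|w']; rewrite ubs.
  by apply/allP=> b /mapP[j _ ->]; apply: filter_subseq.
move/allP=> sub_w'.
have pw : perm_eq (word w') (word w) by rewrite (permPl (perm_word w')) perm_sym perm_word.
have := @shuffle_lexlt col us (word w') usP uu cmono; rewrite def_w => /(_ pw).
case=> [c|/word_inj -> |]; [|by left|by right].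
have [ck|kc] := ltnP c (size q); last first.
  have nil_c s : {subset s <= word w} -> [seq x <- s | col x == c] = [::].
    move=> sw; apply/eqP; rewrite -[_ == _]negbK -has_filter; apply/hasPn => x /sw xw.
    by rewrite neq_ltn (leq_trans _ kc) ?colk ?def_w.
  by rewrite !nil_c // => x; rewrite (perm_mem pw).
(* The colour class is a block of [g], hence a subsequence of [w']; as the letters of [w'] are
   distinct, it is the restriction of [w'] to that class. *)
have /sub_w' : [seq x <- word w | col x == c] \in bs by apply: map_f; rewrite mem_iota.
move/(subseq_uniqP (word_uniq w')) => ->; apply: eq_in_filter => x.
by rewrite (perm_mem pw) mem_filter => ->; rewrite andbT.
Qed.

Variable R : comPzRingType.
Local Open Scope ring_scope.

(** Induction from the largest pivot type downwards: at the test word of [w], besides [w] only words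
    of larger type contribute, and their coefficients already vanish. *)
Lemma Xi_free (c : 'S_n -> R) :
  \sum_(w in Bq n q) c w *: gmul (Xi R n q) (gdelta R w) = 0 ->
  forall w, w \in Bq n q -> c w = 0.
Proof.
move=> sum0 w; have [m] := ubnP #|[set w' : 'S_n | lexlt (pivots (word w)) (pivots (word w'))]|.
elim: m w => // m IHm w; rewrite ltnS => lt_m wB; have [g gw test] := pivot_test wB.
move/ffunP: sum0 => /(_ g); rewrite sum_ffunE ffunE (bigD1 w) //= big1 => [|w' /andP[w'B w'w]].
  by rewrite addr0 ffunE Xi_delta ?is_comp_sumn // -/(unshuffles _ _ _) gw -[_ *: _]/(c w * 1) mulr1.
rewrite ffunE Xi_delta ?is_comp_sumn // -/(unshuffles _ _ _).
have [/test[eq_w|lt_w]|_] := boolP (unshuffles _ _ _); last exact: scaler0.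
  by rewrite eq_w eqxx in w'w.
rewrite IHm ?scale0r //; apply: leq_trans lt_m; apply: proper_card.
apply/properP; split; last by exists w'; rewrite !inE // lexlt_irr.
by apply/subsetP=> t; rewrite !inE; apply: lexlt_trans.
Qed.

Definition spanned (F : 'S_n -> R) : Prop :=
  exists c : 'S_n -> R, forall g,
    F g = \sum_(w in Bq n q) c w * (unshuffles q (word g) (word w))%:R.

Lemma spanned_lin a F G : spanned F -> spanned G -> spanned (fun g => a * F g + G g).
Proof.
case=> [c Fc] [d Gd]; exists (fun w => a * c w + d w) => g.
rewrite Fc Gd mulr_sumr -big_split; apply: eq_bigr => w _.
by rewrite mulrDl mulrA.
Qed.

Lemma spanned0 : spanned (fun=> 0).
Proof. by exists (fun=> 0) => g; rewrite big1 // => w _; rewrite mul0r. Qed.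

Lemma spanned_sum (I : eqType) (r : seq I) (a : I -> R) (F : I -> 'S_n -> R) :
  {in r, forall i, spanned (F i)} -> spanned (fun g => \sum_(i <- r) a i * F i g).
Proof.
elim: r => [|i r IHr] Fr.
  by have [c c0] := spanned0; exists c => g; rewrite big_nil -c0.
have [c cE] : spanned (fun g => a i * F i g + \sum_(i <- r) a i * F i g).
  apply: spanned_lin; first by apply: Fr; rewrite inE eqxx.
  by apply: IHr => j jr; apply: Fr; rewrite inE jr orbT.
by exists c => g; rewrite big_cons cE.
Qed.

(** A letter is coloured by the index of its block in [G]. Whether a block is a subsequence of [v]
    depends only on the restriction of [v] to its colour. *)
Lemma unshuffles_invariant G : uniq G -> size G = n ->
  exists col, [/\ colour_invariant col (fun v => (unshuffles q G v)%:R : R),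
    {in G, forall x, col x < size q}%N &
    forall j, (j < size q)%N -> count (fun x => col x == j) G = nth 0%N q j].
Proof.
move=> Gu Gn; pose bs := reshape q G.
have Gbs : flatten bs = G by rewrite reshapeKr ?Gn ?is_comp_sumn.
have shbs : shape bs = q by rewrite reshapeKl ?Gn ?is_comp_sumn.
have szbs : size bs = size q by rewrite -shbs size_map.
pose col x := find (fun b => x \in b) bs.
have colG x : (x \in G) = (col x < size q)%N.
  rewrite -szbs -has_find -Gbs; apply/flattenP/hasP => [[b]|[b]]; by exists b.
have ubs : uniq (flatten bs) by rewrite Gbs.
have colb j x : (j < size q)%N -> x \in nth [::] bs j -> col x = j.
  by rewrite -szbs => lt_j; apply: find_block.
exists col; split.
- move=> v w vw; congr (_%:R); congr (nat_of_bool _); apply: eq_in_all => b /= bbs.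
  have [j lt_j def_b] : exists2 j, (j < size q)%N & b = nth [::] bs j.
    by exists (index b bs); rewrite ?nth_index // -szbs index_mem.
  have sub_b t : subseq b t = subseq b [seq x <- t | col x == j].
    rewrite subseq_filter; case: allP => // -[] x; rewrite def_b => /(colb j x lt_j) ->.
    exact: eqxx.
  by rewrite sub_b vw -sub_b.
- by move=> x; rewrite colG.
move=> j lt_j; rewrite -size_filter -{1}shbs (nth_map [::]) ?szbs //; apply: perm_size.
apply: uniq_perm; rewrite ?filter_uniq ?uniq_nth_flatten // => x; rewrite mem_filter.
apply/andP/idP => [[/eqP <-]|xj].
  by rewrite colG -szbs -has_find => /(nth_find [::]).
by split; [rewrite (colb j x) | rewrite colG (colb j x)].
Qed.

(** Induction from the smallest pivot type upwards: outside [Bq n q] the Lie product expresses [w]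
    by words of smaller type. Its expansion [L] is the same for all [g]; only the colouring that
    makes it vanish depends on [g]. *)
Lemma spanned_word (w : 'S_n) : spanned (fun g => (unshuffles q (word g) (word w))%:R).
Proof.
have [m] := ubnP #|[set w' : 'S_n | lexlt (pivots (word w')) (pivots (word w))]|.
elim: m w => // m IHm w; rewrite ltnS => lt_m.
have [wB|wNB] := boolP (w \in Bq n q).
  exists (fun w' => (w' == w)%:R) => g; rewrite (bigD1 w) //= eqxx mul1r big1 ?addr0 // => w'.
  by case/andP=> _ /negbTE->; rewrite mul0r.
have [us usP def_w] := pivot_factP (word_uniq w).
have uu : uniq (flatten us) by rewrite def_w word_uniq.
have us0 : all (ltn 0) (shape us) by rewrite -pivots_flatten // pivots_gt0.
have [L Llt Lzero] := lie_product R usP uu.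
have [c cE] : spanned (fun g => \sum_(p <- L) (- (-1) ^+ p.1) * (unshuffles q (word g) p.2)%:R).
  apply: spanned_sum => p /Llt[pp lt_p]; rewrite def_w in pp lt_p.
  have [w' def_p] : exists w' : 'S_n, word w' = p.2.
    by apply: word_surj; rewrite (permPl pp) perm_word.
  rewrite -def_p in lt_p *; apply: IHm; apply: leq_trans lt_m; apply: proper_card.
  apply/properP; split; last by exists w'; rewrite !inE // lexlt_irr.
  by apply/subsetP=> t; rewrite !inE => /lexlt_trans; apply.
exists c => g; rewrite -cE.
have [col [phiP colk ccol]] := unshuffles_invariant (word_uniq g) (size_word g).
have pgw : perm_eq (word g) (word w) by rewrite (permPl (perm_word g)) perm_sym perm_word.
(* If every factor had one colour, the blocks of [g] would group the parts of the pivot type into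
   the parts of [q]. *)
have nmono : ~~ all (mono col) us.
  apply: contra wNB => cmono; rewrite inE; apply/wrefbP.
  rewrite -[pivot_type w]/(pivots (word w)) -def_w pivots_flatten //.
  apply: (mono_wref us0 cmono) => [x|j lt_j]; first by rewrite def_w -(perm_mem pgw); apply: colk.
  by rewrite def_w -ccol //; apply/esym; exact: (seq.permP pgw).
have := Lzero col _ [::] phiP nmono; rewrite /signed_sum big_cons /= expr0 mul1r def_w.
move/eqP; rewrite addr_eq0 => /eqP ->; rewrite -sumrN.
by apply: eq_bigr => p _; rewrite mulNr.
Qed.

Lemma Xi_span (b : {ffun 'S_n -> R^o}) : exists c : 'S_n -> R,
  gmul (Xi R n q) b = \sum_(w in Bq n q) c w *: gmul (Xi R n q) (gdelta R w).
Proof.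
have [c cE] := spanned_sum (r := index_enum 'S_n) b (fun w _ => spanned_word w).
exists c; apply/ffunP=> g; rewrite sum_ffunE.
under eq_bigr => w _ do rewrite ffunE Xi_delta ?is_comp_sumn // -/(unshuffles _ _ _).
rewrite -[RHS]/(\sum_(w in Bq n q) c w * (unshuffles q (word g) (word w))%:R) -cE.
(* The substitution [h = g * w^-1] turns the convolution into a sum over [w] with coefficients
   [b w]. *)
rewrite ffunE (reindex_inj (h := fun w => g * w^-1)%g) /=; last first.
  by move=> s t /mulgI/invg_inj.
apply: eq_bigr => w _; rewrite ffunE invMg invgK mulgKV mulrC desc_in_mulV ?is_comp_sumn //.
by congr (_ * _); rewrite /unshuffles; case: all.
Qed.

End Basis.

(** * From pivot factors to cycles *)

(** Both lists follow the iterates of [f] from [f a] on and stop at the first return to [a]. *)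
Lemma fcycle_rcons_inj (f : nat -> nat) a s t : a \notin s -> a \notin t ->
  fcycle f (rcons s a) -> fcycle f (rcons t a) -> s = t.
Proof.
rewrite -!rot1_cons !rot_cycle /= => + + /fpathP[k] + /fpathP[l].
wlog le_kl : k l s t / k <= l => [IH|] aNs aNt def_s def_t.
  by case/orP: (leq_total k l) => /IH H; [|apply/esym]; apply: H.
have : rcons s a = take k (rcons t a) by rewrite def_t take_traject // def_s.
move/(congr1 (cat^~ (drop k (rcons t a)))); rewrite cat_take_drop cat_rcons -cats1.
by case/cat_rcons_inj.
Qed.

(** The first pivot is the smallest letter, and its cycle under [f] determines the first factor;
    remove it and repeat. *)
Lemma pivot_fact_inj (f : nat -> nat) us us' : pivot_fact us -> pivot_fact us' ->
  perm_eq (flatten us) (flatten us') -> all (fun u => fcycle f u) us ->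
  all (fun u => fcycle f u) us' -> us = us'.
Proof.
move=> usP; elim: usP us' => [|s a {}us sa usa _ IHus] us' [|s' a' {}us' sa' usa' usP'] //=.
- by rewrite cat_rcons => /perm_size /=; rewrite size_cat addnS.
- by rewrite cat_rcons => /perm_size /=; rewrite size_cat addnS.
rewrite !cat_rcons => pp.
have eq_a : a = a'.
  have := perm_mem pp a; have := perm_mem pp a'.
  rewrite !mem_cat !inE !eqxx /= !orbT => /or3P[/(allP sa)|/eqP|/(allP usa)] //= lt_a;
    move/esym/or3P=> [/(allP sa')|/eqP|/(allP usa')] //= lt_a';
    by have := ltn_trans lt_a lt_a'; rewrite ltnn.
rewrite -{a'}eq_a in sa' usa' pp *.
move=> /andP[cs cus] /andP[cs' cus'].
have eq_s := fcycle_rcons_inj (ltn_all_notin sa) (ltn_all_notin sa') cs cs'.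
rewrite -eq_s perm_cat2l perm_cons in pp; rewrite -eq_s.
by congr (_ :: _); apply: IHus.
Qed.

Section FactorCycles.

Variables (T : finType) (fs : seq (seq T)).
Hypotheses (fs_uniq : uniq (flatten fs)) (fsT : forall x, x \in flatten fs).
Hypothesis fs0 : all (ltn 0) (shape fs).

Definition factor_of x := nth [::] fs (find (fun u : seq T => x \in u) fs).

Lemma factor_ofP x u : u \in fs -> x \in u -> factor_of x = u.
Proof.
move=> ufs xu; rewrite /factor_of (find_block (j := index u fs)) ?nth_index ?index_mem //.
Qed.

Lemma factor_of_mem x : (x \in factor_of x) && (factor_of x \in fs).
Proof. by case/flattenP: (fsT x) => u ufs xu; rewrite (factor_ofP ufs xu) xu. Qed.

Lemma factor_uniq u : u \in fs -> uniq u.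
Proof. by move=> ufs; rewrite -(nth_index [::] ufs) uniq_nth_flatten. Qed.

Lemma next_factor_inj : injective (fun x => next (factor_of x) x).
Proof.
apply: (can_inj (g := fun x => prev (factor_of x) x)) => x.
have /andP[xx xfs] := factor_of_mem x.
rewrite (factor_ofP xfs) ?mem_next //.
by rewrite prev_next // factor_uniq.
Qed.

Definition factor_perm : {perm T} := perm next_factor_inj.

Lemma factor_perm_cycle u : u \in fs -> fcycle factor_perm u.
Proof.
move=> ufs; rewrite (eq_in_cycle (P := mem u) (e' := frel (next u))) ?cycle_next ?factor_uniq //.
by move=> x y xu _; rewrite /= permE (factor_ofP ufs xu).
Qed.

Lemma porbit_factor u x : u \in fs -> x \in u -> porbit factor_perm x = [set y in u].
Proof.
move=> ufs xu; apply/setP=> y; rewrite inE -(fconnect_cycle (factor_perm_cycle ufs) xu).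
apply/porbitP/idP => [[i ->]|xy]; first by rewrite permX fconnect_iter.
by exists (findex factor_perm x y); rewrite permX iter_findex.
Qed.

(** The orbits are the letter sets of the factors, which are pairwise distinct because the factors
    are disjoint and not empty. *)
Lemma perm_porbits_factor :
  perm_eq [seq #|(X : {set T})| | X <- enum (porbits factor_perm)] (shape fs).
Proof.
have inj_fs : {in fs &, injective (fun u : seq T => [set y in u])}.
  move=> u u' ufs u'fs /setP eq_u.
  have : 0 < size u by apply: (allP fs0); apply: map_f.
  case def_u : u => [//|x s] _; have xu : x \in u by rewrite def_u inE eqxx.
  rewrite -def_u -(factor_ofP ufs xu); apply: factor_ofP => //.
  by have := eq_u x; rewrite !inE xu.
have ufs : uniq fs.
  elim: fs fs_uniq fs0 => //= u us IHus; rewrite cat_uniq => /and3P[_ uNus usu] /andP[u0 us0].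
  rewrite IHus // andbT; apply: contra uNus => uus; case: u u0 uus => // x u _ uus.
  by apply/hasP; exists x; rewrite ?inE ?eqxx //; apply/flattenP; exists (x :: u); rewrite ?inE ?eqxx.
have -> : shape fs = [seq #|(X : {set T})| | X <- [seq [set y in u] | u : seq T <- fs]].
  rewrite -map_comp; apply/eq_in_map => u uf /=; rewrite cardsE.
  by apply/esym/card_uniqP; apply: factor_uniq.
apply: perm_map; apply: uniq_perm; rewrite ?enum_uniq ?map_inj_in_uniq // => X.
rewrite mem_enum; apply/imsetP/mapP => [[x _ ->]|[u uf ->]].
  have /andP[xx xfs] := factor_of_mem x.
  by exists (factor_of x) => //; apply: porbit_factor.
have : 0 < size u by apply: (allP fs0); apply: map_f.
case def_u : u => [//|x s] _; exists x => //; rewrite -def_u.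
by apply/esym/porbit_factor; rewrite // def_u inE eqxx.
Qed.

End FactorCycles.

Section FundamentalBijection.

Variable n : nat.
Implicit Type w : 'S_n.

Definition factors w : seq (seq 'I_n) := reshape (pivot_type w) [seq w i | i <- enum 'I_n].

Lemma factors_val w : pivot_fact [seq [seq val x | x <- u] | u <- factors w] /\
  flatten [seq [seq val x | x <- u] | u <- factors w] = word w.
Proof.
rewrite map_reshape -map_comp.
have [us usP def_w] := pivot_factP (word_uniq w).
have := pivots_flatten usP; rewrite def_w word_uniq => /(_ isT) pw.
rewrite -[[seq _ | i <- _]]/(word w) -[pivot_type w]/(pivots (word w)) pw.
by rewrite -{1 2}def_w flattenK.
Qed.

Lemma flatten_factors w : flatten (factors w) = [seq w i | i <- enum 'I_n].
Proof.
apply: (inj_map (@ord_inj n)); have [_] := factors_val w.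
by rewrite -map_flatten => ->; rewrite /word map_comp.
Qed.

Lemma shape_factors w : shape (factors w) = pivot_type w.
Proof.
have [usP def_w] := factors_val w; have := pivots_flatten usP.
rewrite def_w word_uniq => /(_ isT) pw; rewrite -[RHS]/(pivots (word w)) pw /shape -map_comp.
by apply: eq_map => u; rewrite /= size_map.
Qed.

Lemma factors_uniq w : uniq (flatten (factors w)).
Proof. by rewrite flatten_factors map_inj_uniq ?enum_uniq //; apply: perm_inj. Qed.

Lemma mem_factors w x : x \in flatten (factors w).
Proof. by rewrite flatten_factors -[x](permKV w) map_f // mem_enum. Qed.

Lemma factors_gt0 w : all (ltn 0) (shape (factors w)).
Proof. by rewrite shape_factors pivots_gt0 // word_uniq. Qed.

(** This is Foata's fundamental transformation: every cycle is written with its minimum last, and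
    the cycles are listed by increasing minima. *)
Definition cycle_perm w : 'S_n := factor_perm (factors_uniq w) (mem_factors w).

Lemma cycle_type_cycle_perm w : perm_eq (cycle_type (cycle_perm w)) (pivot_type w).
Proof. by rewrite -shape_factors; apply: perm_porbits_factor; apply: factors_gt0. Qed.

Lemma cycle_perm_inj : injective cycle_perm.
Proof.
move=> w w' eq_w; have [usP def_w] := factors_val w; have [usP' def_w'] := factors_val w'.
(* [pivot_fact_inj] concerns letters in [nat], so the permutation is extended by the identity. *)
pose f x := if insub x is Some i then val (cycle_perm w i) else x.
have fE (i : 'I_n) : f (val i) = val (cycle_perm w i) by rewrite /f valK.
have cyc (t : 'S_n) : cycle_perm t = cycle_perm w ->
    all (fun u => fcycle f u) [seq [seq val x | x <- u] | u <- factors t].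
  move=> eq_t; apply/allP=> _ /mapP[u ut ->].
  have := factor_perm_cycle (factors_uniq t) (mem_factors t) ut.
  rewrite -/(cycle_perm t) eq_t; case: u {ut} => //= x u.
  rewrite -map_rcons path_map; apply: sub_path => y z /=.
  by rewrite fE => /eqP ->.
apply: word_inj; rewrite -def_w -def_w'; congr flatten.
apply: (pivot_fact_inj (f := f)) => //; [|exact: cyc|exact: cyc].
by rewrite def_w def_w' (permPl (perm_word w)) perm_sym perm_word.
Qed.

End FundamentalBijection.

Lemma wref_perm r r' q : perm_eq r r' -> wref r q -> wref r' q.
Proof.
move=> pr [cs [szcs csq pcs]]; exists cs; split=> //.
by rewrite -(permPl pr).
Qed.

Lemma wrefb_perm r r' q : perm_eq r r' -> wrefb r q = wrefb r' q.
Proof.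
move=> pr; apply/wrefbP/wrefbP; apply: wref_perm => //.
by rewrite perm_sym.
Qed.

Lemma card_Bq_cycle n q : #|Bq n q| = #|[set s : 'S_n | wrefb (cycle_type s) q]|.
Proof.
rewrite -(card_imset (mem (Bq n q)) (@cycle_perm_inj n)); congr #|pred_of_set _|; apply/setP=> s.
have [w ->] : exists w, s = cycle_perm w.
  by have [g _ gK] := injF_bij (@cycle_perm_inj n); exists (g s); rewrite gK.
rewrite mem_imset; last exact: cycle_perm_inj.
by rewrite !inE (wrefb_perm q (cycle_type_cycle_perm w)).
Qed.

(** * Counting words by pivot type *)

Lemma pivots_cons y t : uniq (y :: t) ->
  pivots (y :: t) = if all (ltn y) t then 1 :: pivots t
                    else (head 0 (pivots t)).+1 :: behead (pivots t).
Proof.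
rewrite cons_uniq => /andP[yNt tu]; case: ifPn => [yt|yt]; first by rewrite (@pivots_split y [::]).
have tn0 : t != [::] by apply: contraNneq yt => ->.
have [s [a [r [def_t sa ra]]]] := min_split tn0 tu.
have ru : uniq r by move: tu; rewrite def_t cat_uniq /= => /and3P[_ _ /andP[]].
have ay : a < y.
  rewrite ltnNge leq_eqVlt; apply: contra yt => /orP[/eqP ya|ya].
    by rewrite def_t mem_cat inE ya eqxx orbT in yNt.
  rewrite def_t all_cat /= ya; apply/andP.
  by split; apply/allP=> z zs; apply: ltn_trans ya _; [apply: (allP sa)|apply: (allP ra)].
by rewrite def_t -cat_cons !pivots_split //= ay.
Qed.

(** A first part [x] puts the minimum at position [x]; the falling factorial counts the ways to fill
    the [x.-1] positions before it from the other letters. *)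
Fixpoint pivot_count (c : seq nat) : nat :=
  if c is x :: c' then (x.-1 + sumn c') ^_ x.-1 * pivot_count c' else 1.

(* Deleting the first letter of a word either removes a first part equal to 1 (when that letter is
   the minimum) or lowers the first part by 1. *)
Lemma count_pivots c S : uniq S -> size S = sumn c -> all (ltn 0) c ->
  count (fun v => pivots v == c) (permutations S) = pivot_count c.
Proof.
elim: {S}(size S) {-2}S (erefl (size S)) c => [|n IHn] S Sn c Su.
  rewrite (size0nil Sn); case: c => //= x c /esym/eqP.
  by rewrite addn_eq0 => /andP[/eqP ->].
case: c => [|x c]; first by rewrite Sn.
rewrite Sn => sz /= /andP[x0 c0].
have Sn0 : S != [::] by rewrite -size_eq0 Sn.
have [s [a [t [def_S sa ta]]]] := min_split Sn0 Su.
have pS : perm_eq S (a :: s ++ t) by rewrite def_S -cat1s perm_catCA.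
have szst : size (s ++ t) = n by move/perm_size: pS; rewrite Sn => -[].
have aNst : a \notin s ++ t by have := Su; rewrite (perm_uniq pS) /= => /andP[].
have sta : all (ltn a) (s ++ t) by rewrite all_cat sa.
have szrem y : y \in S -> size (rem y S) = n by move=> yS; rewrite size_rem // Sn.
have step y : y \in S -> {in permutations (rem y S), forall v, pivots (y :: v) =
    if y == a then 1 :: pivots v else (head 0 (pivots v)).+1 :: behead (pivots v)}.
  move=> yS v; rewrite mem_permutations => pv.
  have py : perm_eq (y :: v) S by rewrite perm_sym (permPl (perm_to_rem yS)) perm_cons perm_sym.
  rewrite pivots_cons ?(perm_uniq py) //; congr (if _ then _ else _).
  have [ya|ya] := eqVneq y a.
    rewrite ya in py *; have := py; rewrite (permPr pS) perm_cons => pv'.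
    by rewrite (perm_all _ pv').
  apply/negbTE; apply/allPn; exists a.
    have : a \in y :: v by rewrite (perm_mem py) (perm_mem pS) inE eqxx.
    by rewrite inE eq_sym (negbTE ya).
  have : y \in s ++ t by have := yS; rewrite (perm_mem pS) inE (negbTE ya).
  by move/(allP sta) => /= ay; rewrite -leqNgt ltnW.
pose f y := count (fun v => pivots (y :: v) == x :: c) (permutations (rem y S)).
have -> : count (fun v => pivots v == x :: c) (permutations S) = \sum_(y <- S) f y.
  have S0 : 0 < size S by rewrite Sn.
  rewrite (seq.permP (permutationsE S0)) undup_id // count_flatten sumnE !big_map.
  by apply: eq_bigr => y _; rewrite count_map.
rewrite (perm_big _ pS) big_cons.
have aS : a \in S by rewrite (perm_mem pS) inE eqxx.
have remu y : uniq (rem y S) by apply: rem_uniq.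
have fa : f a = if x == 1 then pivot_count c else 0.
  transitivity (count (fun v => (x == 1) && (pivots v == c)) (permutations (rem a S))).
    by apply: eq_in_count => v /(step a aS) ->; rewrite eqxx eqseq_cons eq_sym.
  have [x1|x1] := eqVneq x 1; last exact: count_pred0.
  by rewrite IHn ?szrem //; move: sz; rewrite x1 => -[].
(* After deleting a letter other than the minimum, the first part must be [x.-1], which is
   impossible for [x = 1] as parts are positive. *)
have fst y : y \in s ++ t -> f y = if x == 1 then 0 else pivot_count (x.-1 :: c).
  move=> yst; have yS : y \in S by rewrite (perm_mem pS) inE yst orbT.
  have ya : y == a = false by apply: contraNF aNst => /eqP <-.
  have n0 : 0 < n by rewrite -szst; case: (s ++ t) yst.
  transitivity (count (fun v => pivots v == x.-1 :: c) (permutations (rem y S))).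
    apply: eq_in_count => v vp; rewrite (step y yS v vp) ya; move: vp; rewrite mem_permutations => vp.
    have vu : uniq v by rewrite (perm_uniq vp).
    have := sumn_pivots vu; rewrite (perm_size vp) szrem //.
    case: (pivots v) => [/= n0'|z r _]; first by rewrite -n0' in n0.
    by rewrite /= !eqseq_cons -{1}(prednK x0) eqSS.
  have [x1|x1] := eqVneq x 1.
    apply/eqP; rewrite -leqn0 leqNgt -has_count; apply/hasPn => v.
    rewrite mem_permutations => vp; have vu : uniq v by rewrite (perm_uniq vp).
    by apply: contraTneq (pivots_gt0 vu) => ->; rewrite x1.
  case: x x0 x1 sz {f step fa} => [|[|x]] // _ _ [sz].
  by rewrite IHn ?szrem.
rewrite fa (eq_big_seq _ fst) big_const_seq count_predT szst iter_addn_0.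
case: x x0 sz {f step fa fst} => [|[|x]] //= _ [sz].
by rewrite add0n sz addSn ffactSS mulnC mulnA.
Qed.

(** * Centralizer orders and the sum over arrangements of a partition *)

Lemma zee_sup l s : uniq s -> {subset l <= s} ->
  zee l = \prod_(i <- s) (i ^ (count_mem i l) * (count_mem i l)`!).
Proof.
move=> su ls; rewrite /zee.
have pl : perm_eq (undup l) [seq i <- s | i \in l].
  apply: uniq_perm; rewrite ?undup_uniq ?filter_uniq // => i.
  by rewrite mem_undup mem_filter andb_idr //; apply: ls.
rewrite (perm_big _ pl) big_filter big_mkcond; apply: eq_bigr => i _.
by case: ifPn => // /count_memPn ->.
Qed.

Lemma zee_rem x l : x \in l -> zee l = x * count_mem x l * zee (rem x l).
Proof.
move=> xl; have lu := undup_uniq l.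
rewrite (zee_sup lu) => [|i]; last by rewrite mem_undup.
rewrite (zee_sup (l := rem x l) lu) => [|i /mem_rem]; last by rewrite mem_undup.
rewrite !(bigD1_seq x) ?mem_undup //= !count_mem_rem eqxx !mulnA; congr (_ * _); last first.
  apply: eq_bigr => i ix; rewrite count_mem_rem eq_sym (negbTE ix) subn0 //.
have : 0 < count_mem x l by rewrite -has_count has_pred1.
case: (count_mem x l) => // m _; rewrite subn1 /= expnS factS.
by rewrite -!mulnA; congr (_ * _); rewrite mulnCA.
Qed.

Lemma zee_gt0 l : all (ltn 0) l -> 0 < zee l.
Proof.
move=> l0; rewrite /zee big_seq prodn_cond_gt0 // => i; rewrite mem_undup => /(allP l0) /= i0.
by rewrite muln_gt0 expn_gt0 i0 fact_gt0.
Qed.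

Lemma sumn_undup l : sumn l = \sum_(x <- undup l) x * count_mem x l.
Proof.
rewrite sumnE -(big_undup_iterop_count _ l predT); apply: eq_bigr => x _.
by rewrite Monoid.iteropE iter_addn_0.
Qed.

(** Sort the arrangements by their first part [x]. By [zee_rem] and induction, [x] contributes [x]
    times its multiplicity times the factorial of [(sumn l).-1]; these weights add up to
    [sumn l]. *)
Lemma sum_pivot_count l : all (ltn 0) l ->
  (\sum_(c <- permutations l) pivot_count c) * zee l = (sumn l)`!.
Proof.
elim: {l}(size l) {-2}l (erefl (size l)) => [|m IHm] l lm l0.
  by rewrite (size0nil lm) /zee /= !big_cons !big_nil.
have l_gt0 : 0 < size l by rewrite lm.
rewrite (perm_big _ (permutationsE l_gt0)) big_allpairs_dep big_distrl /=.
have sl0 : 0 < sumn l by case: (l) l0 l_gt0 => //= x l' /andP[x0 _] _; rewrite addn_gt0 x0.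
rewrite -(prednK sl0) factS (prednK sl0) [X in _ = X * _]sumn_undup big_distrl /=.
apply: eq_big_seq => x; rewrite mem_undup => xl.
have x0 : 0 < x := allP l0 x xl.
have pl := perm_to_rem xl; have := perm_sumn pl => /= sl.
have l0' : all (ltn 0) (rem x l) by move: l0; rewrite (perm_all _ pl) => /andP[].
have szl : size (rem x l) = m by rewrite size_rem // lm.
have sl1 : (sumn l).-1 = x.-1 + sumn (rem x l) by rewrite sl -{1}(prednK x0).
have -> : \sum_(c <- permutations (rem x l)) ((x.-1 + sumn c) ^_ x.-1 * pivot_count c) =
    (sumn l).-1 ^_ x.-1 * \sum_(c <- permutations (rem x l)) pivot_count c.
  rewrite big_distrr; apply: eq_big_seq => c /=; rewrite mem_permutations => /perm_sumn ->.
  by rewrite sl1.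
rewrite (zee_rem xl) mulnACA IHm // -mulnA mulnCA; congr (_ * _).
by rewrite sl1 -[in RHS](ffact_fact (leq_addr (sumn (rem x l)) x.-1)) addKn.
Qed.

Lemma count_pivots_perm l S : uniq S -> size S = sumn l -> all (ltn 0) l ->
  count (fun v => perm_eq (pivots v) l) (permutations S) * zee l = (sumn l)`!.
Proof.
move=> Su Sl l0; rewrite -sum_pivot_count //; congr (_ * _).
transitivity (\sum_(c <- permutations l) count (fun v => pivots v == c) (permutations S)).
  under eq_bigr do rewrite -sum1_count big_mkcond.
  rewrite -sum1_count big_mkcond exchange_big; apply: eq_bigr => v _.
  rewrite -mem_permutations -big_mkcond sum1_count.
  have := count_uniq_mem (pivots v) (permutations_uniq l) => /=.
  by rewrite -[in X in X -> _](eq_count (a1 := fun c => pivots v == c)) => [->|c] //; rewrite /= eq_sym.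
apply: eq_big_seq => c; rewrite mem_permutations => pc.
by rewrite count_pivots ?(perm_sumn pc) ?(perm_all _ pc).
Qed.

Lemma card_word n (P : pred (seq nat)) :
  #|[set w : 'S_n | P (word w)]| = count P (permutations (iota 0 n)).
Proof.
have pw : perm_eq [seq word w | w <- enum 'S_n] (permutations (iota 0 n)).
  apply: uniq_perm; rewrite ?permutations_uniq ?(map_inj_uniq (@word_inj n)) ?enum_uniq // => v.
  rewrite mem_permutations; apply/mapP/idP => [[w _ ->]|/word_surj[w <-]].
    exact: perm_word.
  by exists w; rewrite ?mem_enum.
by rewrite -(seq.permP pw) count_map cardsE cardE enumT size_filter.
Qed.

(** * Partitions as padded tuples *)

Lemma geq_trans : transitive geq.
Proof. by move=> y x z /= yx zy; apply: leq_trans yx. Qed.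

Lemma sorted_geq_pad s : sorted geq s ->
  s = [seq x <- s | 0 < x] ++ nseq (size s - size [seq x <- s | 0 < x]) 0.
Proof.
elim: s => // -[|x] s IHs /= xs; last first.
  by rewrite subSS -IHs // (path_sorted xs).
have s0 : s = nseq (size s) 0.
  apply/all_pred1P/allP=> y ys; have /allP := order_path_min geq_trans xs.
  by move/(_ y ys) => /=; rewrite leqn0.
have -> : [seq x <- s | 0 < x] = [::] by rewrite s0; elim: (size s).
by rewrite subn0 /= -s0.
Qed.

Section PaddedPartitions.

Variable n : nat.
Implicit Types (c : seq nat) (t : n.-tuple 'I_n.+1).

(** The default 0 of [nth] supplies the padding. For a composition of [n] all parts are at most [n],
    so [inord] keeps their values. *)
Definition pad c : n.-tuple 'I_n.+1 := [tuple inord (nth 0 (sort geq c) i) | i < n].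

Lemma size_comp c : is_comp n c -> size c <= n.
Proof.
case/andP=> c0 /eqP <-; elim: c c0 => //= x c IHc /andP[x0 /IHc].
by move=> /(leq_add x0); rewrite add1n.
Qed.

Lemma val_pad c : is_comp n c -> map val (pad c) = sort geq c ++ nseq (n - size c) 0.
Proof.
move=> cn; have sc := size_comp cn.
apply: (@eq_from_nth _ 0); first by rewrite size_map size_tuple size_cat size_nseq size_sort subnKC.
rewrite size_map size_tuple => i lt_i; rewrite (nth_map ord0) ?size_tuple //.
rewrite (_ : nth ord0 (pad c) i = tnth (pad c) (Ordinal lt_i)) ?(tnth_nth ord0) // -(tnth_nth _ _ (Ordinal lt_i)).
rewrite tnth_mktuple /= inordK; last first.
  rewrite ltnS; have [lt_ic|] := ltnP i (size c); last by move=> ?; rewrite nth_default ?size_sort.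
  have /andP[_ /eqP <-] := cn; rewrite -(perm_sumn (permEl (perm_sort geq c))).
  by rewrite -(size_sort geq) in lt_ic; rewrite sumnE (big_nth 0) big_mkord (bigD1 (Ordinal lt_ic)) //= leq_addr.
rewrite nth_cat size_sort; case: ltnP => // ci.
by rewrite nth_nseq if_same nth_default ?size_sort.
Qed.

Lemma pad_partition c : is_comp n c -> tup_is_partition (pad c).
Proof.
move=> cn; have /andP[_ /eqP sc] := cn; rewrite /tup_is_partition val_pad //; apply/andP; split.
  rewrite (sorted_pairwise geq_trans) pairwise_cat -!(sorted_pairwise geq_trans).
  rewrite sort_sorted; last by move=> x y; apply: leq_total.
  apply/and3P; split=> //; first by apply/allrelP=> x y _ /nseqP[-> _].
  by elim: (n - size c) => // -[|m].
by rewrite sumn_cat sumn_nseq mul0n addn0 (perm_sumn (permEl (perm_sort geq c))) sc.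
Qed.

(** Parts have only one weakly decreasing arrangement, and their number fixes the padding. *)
Lemma perm_tup_partition c t : is_comp n c -> tup_is_partition t ->
  perm_eq c (tup_partition t) = (pad c == t).
Proof.
move=> cn /andP[st _]; have /andP[c0 _] := cn; apply/idP/eqP => [pc|<-].
  have eq_c : sort geq c = tup_partition t.
    apply: (sorted_eq geq_trans) => //.
    - by move=> x y /= /andP[xy yx]; apply/eqP; rewrite eqn_leq xy yx.
    - by apply: sort_sorted => x y; apply: leq_total.
    - by apply: sorted_filter => //; apply: geq_trans.
    by rewrite perm_sort.
  apply: val_inj; apply: (inj_map val_inj); rewrite val_pad // eq_c (sorted_geq_pad st).
  by rewrite size_map size_tuple -(size_sort geq) eq_c.
rewrite /tup_partition val_pad // filter_cat.
have -> : [seq x <- nseq (n - size c) 0 | 0 < x] = [::] by elim: (n - size c).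
have /all_filterP -> : all (fun x => 0 < x) (sort geq c) by rewrite all_sort.
by rewrite cats0 perm_sym perm_sort.
Qed.

End PaddedPartitions.

(** Classify the words by the partition underlying their pivot type; [count_pivots_perm] gives the
    size of each class. *)
Lemma card_Bq_partition n q : #|Bq n q| =
  \sum_(t : n.-tuple 'I_n.+1 | tup_is_partition t && wrefb (tup_partition t) q)
     n`! %/ zee (tup_partition t).
Proof.
have pn (w : 'S_n) : is_comp n (pivot_type w).
  apply/andP; split; first exact: pivots_gt0 (word_uniq w).
  by rewrite -[pivot_type w]/(pivots (word w)) sumn_pivots ?word_uniq // size_word.
pose part_of (w : 'S_n) := pad n (pivot_type w).
have part_ofE w t : tup_is_partition t -> (part_of w == t) = perm_eq (pivot_type w) (tup_partition t).
  by move=> tP; rewrite perm_tup_partition.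
rewrite -sum1_card (partition_big part_of
  (fun t => tup_is_partition t && wrefb (tup_partition t) q)) => [|w]; last first.
  have wP := pad_partition (pn w); rewrite inE wP /= => wq.
  by rewrite -(wrefb_perm (r := pivot_type w)) // -part_ofE.
apply: eq_bigr => t /andP[tP tq].
have t0 : all (ltn 0) (tup_partition t) by apply: filter_all.
have tn : sumn (tup_partition t) = n.
  have /andP[/sorted_geq_pad def_t /eqP] := tP; rewrite [in X in X -> _]def_t.
  by rewrite sumn_cat sumn_nseq mul0n addn0.
have := count_pivots_perm (iota_uniq 0 n) _ t0; rewrite size_iota tn => /(_ erefl) <-.
rewrite mulnK ?zee_gt0 //.
rewrite -card_word -sum1_card; apply: eq_bigl => w; rewrite !inE part_ofE //.
apply: andb_idl => /(wrefb_perm q) ->.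
exact: tq.
Qed.

Local Open Scope ring_scope.

Theorem mainTheorem16 (R : comPzRingType) (n : nat) (q : seq nat)
  (hq : is_comp n q) :
  (* linear independence over R of {Xi^q w : w in B_q} *)
  (forall c : 'S_n -> R,
     \sum_(w in Bq n q) c w *: gmul (Xi R n q) (gdelta R w) = 0 ->
     forall w, w \in Bq n q -> c w = 0) /\
  (* they span X^q = Xi^q R S_n *)
  (forall b : {ffun 'S_n -> R^o}, exists c : 'S_n -> R,
     gmul (Xi R n q) b = \sum_(w in Bq n q) c w *: gmul (Xi R n q) (gdelta R w)) /\
  (* each basis element lies in X^q (trivially) and the rank formulas *)
  #|Bq n q| = (\sum_(t : n.-tuple 'I_n.+1 |
                  tup_is_partition t && wrefb (tup_partition t) q)
                 n`! %/ zee (tup_partition t))%N /\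
  #|Bq n q| = #|[set s : 'S_n | wrefb (cycle_type s) q]|.
Proof.
split; first exact: Xi_free.
split; first exact: Xi_span.
by split; [apply: card_Bq_partition | apply: card_Bq_cycle].
Qed.
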